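(* Let $\mathbf{D}$ be the finitary distribution monad and $\mathbf{M}$ the maybe monad on the category of sets. Normalization, $(-)^{\circ}\colon\mathbf{D}\mathbf{M}X\to\mathbf{M}\mathbf{D}X$, is an almost-distributive law of $\mathbf{D}$ over $\mathbf{M}$.
   Context: Distribution monad: $\mathbf{D}X$ is the set of finite formal sums $\sum_i\lambda_i|x_i\rangle$ with $x_i\in X$, $\lambda_i>0$, $\sum_i\lambda_i=1$; unit $\eta^{\mathbf D}(x)=|x\rangle$; multiplication $\mu^{\mathbf D}(\sum_i\lambda_i|\sum_j\mu_{ij}|x_{ij}\rangle\rangle)=\sum_{i,j}\lambda_i\mu_{ij}|x_{ij}\rangle$. Maybe monad: $\mathbf{M}X=X+\{\bot\}$, with unit the inclusion and multiplication $\mathbf{M}\mathbf{M}X=X+\{\bot_1\}+\{\bot_2\}\to \mathbf{M}X$ sending both extra points to $\bot$. An element of $\mathbf{D}\mathbf{M}X$ is identified with a subdistribution, i.e. a finite formal sum $\sum_i\lambda_i|x_i\rangle$ over $X$ with $\lambda_i>0$ and $\sum_i\lambda_i\le 1$ (the missing mass is the coefficient of $\bot$). The zero formal sum $0$ stands for $|\bot\rangle\in\mathbf{D}\mathbf{M}X$ and also for $\bot\in\mathbf{M}\mathbf{D}X$. Normalization: $(\sum_i\lambda_i|x_i\rangle)^\circ=\sum_i\frac{\lambda_i}{\sum_k\lambda_k}|x_i\rangle$ if $\sum_k\lambda_k\neq0$, and $(0)^\circ=0$. Almost-distributive law: given monads $(T,\mu^T,\eta^T)$ and $(S,\mu^S,\eta^S)$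 on a category, an almost-distributive law of $T$ over $S$ is a natural transformation $\psi_X\colon TSX\to STX$ with (1) $\psi_X\circ T(\mu^S_X)=\mu^S_{TX}\circ S(\psi_X)\circ\psi_{SX}$; (2) $\psi_X\circ\eta^T_{SX}=S(\eta^T_X)$; (3) $\psi_X\circ T(\eta^S_X)=\eta^S_{TX}$. *)

(* Defs.v *)
From mathcomp Require Import all_boot all_order all_algebra.
From mathcomp Require Import finmap.
From mathcomp Require Import boolp classical_sets functions cardinality fsbigop.
From mathcomp Require Import reals.
Set Implicit Arguments.
Unset Strict Implicit.
Unset Printing Implicit Defensive.
Import Order.TTheory GRing.Theory Num.Theory.
Local Open Scope classical_set_scope.
Local Open Scope ring_scope.

(** * Categories, monads, almost-distributive laws *)

Record category := Category {
  ob :> Type;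
  hom : ob -> ob -> Type;
  idm : forall a, hom a a;
  compm : forall a b c, hom b c -> hom a b -> hom a c;
  compmA : forall a b c d (h : hom c d) (g : hom b c) (f : hom a b),
    compm h (compm g f) = compm (compm h g) f;
  comp1m : forall a b (f : hom a b), compm (idm b) f = f;
  compm1 : forall a b (f : hom a b), compm f (idm a) = f
}.
Arguments idm {C} a : rename.
Arguments compm {C a b c} _ _ : rename.
Notation "g \c f" := (compm g f) (at level 40, left associativity).

Record functor (C D : category) := Functor {
  fob :> C -> D;
  fmap : forall a b : C, hom a b -> hom (fob a) (fob b);
  fmap_id : forall a : C, fmap (idm a) = idm (fob a);
  fmap_comp : forall (a b c : C) (g : hom b c) (f : hom a b),
    fmap (g \c f) = fmap g \c fmap f
}.
Arguments fmap {C D} F {a b} _ : rename.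

Record monad (C : category) := Monad {
  mfun :> functor C C;
  eta : forall a : C, hom a (mfun a);
  mu : forall a : C, hom (mfun (mfun a)) (mfun a);
  eta_natural : forall (a b : C) (f : hom a b),
    eta b \c f = fmap mfun f \c eta a;
  mu_natural : forall (a b : C) (f : hom a b),
    mu b \c fmap mfun (fmap mfun f) = fmap mfun f \c mu a;
  mu_assoc : forall a : C, mu a \c fmap mfun (mu a) = mu a \c mu (mfun a);
  mu_etal : forall a : C, mu a \c eta (mfun a) = idm (mfun a);
  mu_etar : forall a : C, mu a \c fmap mfun (eta a) = idm (mfun a)
}.
Arguments eta {C} m a.
Arguments mu {C} m a.

(** The remaining axiom of a distributive law, compatibility with the
    multiplication of [T], is absent. *)
Record almost_distributive_law (C : category) (T S : monad C)
    (psi : forall X : C, hom (T (S X)) (S (T X))) : Prop :=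
  AlmostDistributiveLaw {
  adl_natural : forall (X Y : C) (f : hom X Y),
    psi Y \c fmap T (fmap S f) = fmap S (fmap T f) \c psi X;
  adl_multS : forall X : C,
    psi X \c fmap T (mu S X) = mu S (T X) \c fmap S (psi X) \c psi (S X);
  adl_unitT : forall X : C, psi X \c eta T (S X) = fmap S (eta T X);
  adl_unitS : forall X : C, psi X \c fmap T (eta S X) = eta S (T X)
}.
Arguments almost_distributive_law {C} T S psi.

Definition Sets : category :=
  @Category Type (fun X Y => X -> Y) (fun X x => x)
    (fun X Y Z g f x => g (f x))
    (fun _ _ _ _ _ _ _ => erefl) (fun _ _ _ => erefl) (fun _ _ _ => erefl).

(** * The maybe monad *)

Definition maybe_functor : functor Sets Sets.
Proof.
refine (@Functor Sets Sets option (fun X Y f => omap f) _ _).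
- by move=> X; apply/funext => -[].
- by move=> X Y Z g f; apply/funext => -[].
Defined.

Definition maybe_join (X : Type) (m : option (option X)) : option X :=
  if m is Some m' then m' else None.

Definition Maybe : monad Sets.
Proof.
refine (@Monad Sets maybe_functor (fun X => @Some X) maybe_join _ _ _ _ _).
- by [].
- by move=> X Y f; apply/funext => -[[]|].
- by move=> X; apply/funext => -[[]|].
- by [].
- by move=> X; apply/funext => -[].
Defined.

(** * Finite formal sums *)

(** The type [{classic X}] is [X] with a classical choice structure, required by
    [\sum_(_ \in _)].  That sum is [0] when the support of [f] is infinite; it is
    only used below for finitely supported [f]. *)
Definition fsum (R : realType) (X : Type) (f : X -> R) : R :=
  \sum_(x \in [set: {classic X}]) f x.

Definition supp (R : realType) (X : Type) (f : X -> R) : set X :=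
  [set x | f x != 0].

Lemma eq_fsum (R : realType) (X : Type) (f g : X -> R) :
  f =1 g -> fsum f = fsum g.
Proof. by move=> fg; congr fsum; apply/funext. Qed.

Lemma fsum_seq (R : realType) (X : Type) (A : {fset {classic X}}) (f : X -> R) :
  (forall x : {classic X}, f x != 0 -> x \in A) ->
  fsum f = \sum_(x <- A) f (x : {classic X}).
Proof.
move=> fA; apply: fsbigTE => x; apply: contraNeq; exact: fA.
Qed.

Lemma fsum_ge0 (R : realType) (X : Type) (f : X -> R) :
  (forall x, 0 <= f x) -> 0 <= fsum f.
Proof. by move=> f0; apply: fsumr_ge0. Qed.

Lemma fsum_single (R : realType) (X : Type) (a : X) (f : X -> R) :
  (forall x, x <> a -> f x = 0) -> fsum f = f a.
Proof.
move=> fa; rewrite (@fsum_seq _ _ [fset (a : {classic X})]%fset).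
  by rewrite big_seq_fset1.
move=> x fx; rewrite inE; apply/eqP; apply: contrapT => /fa fx0.
by rewrite fx0 eqxx in fx.
Qed.

Lemma fsum_mulr (R : realType) (X : Type) (c : R) (f : X -> R) :
  fsum (fun x => f x * c) = fsum f * c.
Proof. by rewrite /fsum mulr_fsuml. Qed.

Lemma fsum_mull (R : realType) (X : Type) (c : R) (f : X -> R) :
  fsum (fun x => c * f x) = c * fsum f.
Proof. by rewrite /fsum mulr_fsumr. Qed.

Lemma fsum_neq0 (R : realType) (X : Type) (f : X -> R) :
  fsum f != 0 -> exists x, f x != 0.
Proof.
apply: contra_neqP => nf; apply: fsbig1 => x _.
by apply/eqP; apply: contrapT => fx; apply: nf; exists x; apply/negP.
Qed.

Lemma fsum_exchange (R : realType) (X Y : Type) (d : X -> R) (g : X -> Y -> R) :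
  finite_set (supp d) -> (forall x, finite_set (supp (g x))) ->
  fsum (fun y => fsum (fun x => d x * g x y)) = fsum (fun x => d x * fsum (g x)).
Proof.
move=> find fing; pose A : {fset {classic X}} := fset_set (supp d : set {classic X}).
have suppA (x : {classic X}) : d x != 0 -> x \in A.
  by move=> dx; rewrite in_fset_set// inE.
have finB : finite_set (\bigcup_(x in supp d) supp (g x)).
  by apply: bigcup_finite.
pose B : {fset {classic Y}} := 
    fset_set (\bigcup_(x in supp d) supp (g x) : set {classic Y}).
have suppB (x : X) (y : {classic Y}) : d x != 0 -> g x y != 0 -> y \in B.
  by move=> dx gxy; rewrite in_fset_set// inE; exists x.
have suppAf (f : X -> R) (x : {classic X}) : d x * f x != 0 -> x \in A.
  by rewrite mulf_eq0 negb_or => /andP[/suppA].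
rewrite (fsum_seq (suppAf _)) (@fsum_seq _ _ B); last first.
  move=> y /fsum_neq0[x]; rewrite mulf_eq0 negb_or => /andP[]; exact: suppB.
under eq_bigr do rewrite (fsum_seq (suppAf _)).
rewrite exchange_big/=; apply: eq_bigr => x _; rewrite -big_distrr/=.
have [->|dx] := eqVneq (d x) 0; first by rewrite !mul0r.
by rewrite (@fsum_seq _ _ B)// => y; apply: suppB.
Qed.

(** * The distribution monad *)

(** The formal sum [\sum_i l_i |x_i>] is represented by its coefficient function
    [x |-> \sum_(i | x_i = x) l_i]; the conditions [l_i > 0] become
    nonnegativity, the terms being indexed by the finite support. *)
Record dist (R : realType) (X : Type) := Dist {
  coef :> X -> R;
  coef_ge0 : forall x, 0 <= coef x;
  coef_finite : finite_set (supp coef);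
  coef_sum1 : fsum coef = 1
}.

Lemma distP (R : realType) (X : Type) (d e : dist R X) : d =1 e -> d = e.
Proof.
case: d e => [d d0 d1 d2] [e e0 e1 e2] /= /funext de.
by case: _ / de in e0 e1 e2 *; congr Dist; exact: Prop_irrelevance.
Qed.

(** The formal sum [|x>]. *)
Definition dirac (R : realType) (X : Type) (x : X) : dist R X.
Proof.
refine (@Dist R X (fun y => `[< y = x >]%:R) _ _ _).
- by move=> y; rewrite ler0n.
- apply: (sub_finite_set _ (finite_set1 x)) => y /=.
  by rewrite /supp/= pnatr_eq0 eqb0 negbK => /asboolP.
- rewrite (@fsum_single _ _ x); first by rewrite asboolT.
  by move=> y yx; rewrite asboolF.
Defined.

(** The convex combination [\sum_i l_i k(x_i)], for [d = \sum_i l_i |x_i>]. *)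
Definition convex_comb (R : realType) (X Y : Type) (d : dist R X)
  (k : X -> dist R Y) : dist R Y.
Proof.
refine (@Dist R Y (fun y => fsum (fun x => d x * k x y)) _ _ _).
- by move=> y; apply: fsum_ge0 => x; rewrite mulr_ge0 ?coef_ge0.
- apply: (@sub_finite_set _ _ (\bigcup_(x in supp d) supp (k x))).
    move=> y /fsum_neq0[x]; rewrite mulf_eq0 negb_or => /andP[dx kxy].
    by exists x.
  by apply: bigcup_finite => *; exact: coef_finite.
- rewrite (fsum_exchange (coef_finite d) (fun x => coef_finite (k x))).
  rewrite -(coef_sum1 d); apply: eq_fsum => x.
  by rewrite coef_sum1 mulr1.
Defined.

(** [\sum_i l_i |x_i>] is sent to [\sum_i l_i |f x_i>]. *)
Definition dist_map (R : realType) (X Y : Type) (f : X -> Y) (d : dist R X) :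
  dist R Y := convex_comb d (fun x => dirac R (f x)).

(** [\sum_i l_i |d_i>] is sent to [\sum_i l_i d_i]. *)
Definition dist_join (R : realType) (X : Type) (dd : dist R (dist R X)) :
  dist R X := convex_comb dd (fun d => d).

Lemma convex_comb_dirac (R : realType) (X : Type) (d : dist R X) :
  convex_comb d (@dirac R X) = d.
Proof.
apply: distP => y /=; rewrite (@fsum_single _ _ y).
  by rewrite asboolT// mulr1.
by move=> x xy; rewrite asboolF ?mulr0// => yx; exact: xy.
Qed.

Lemma dirac_convex_comb (R : realType) (X Y : Type) (x : X)
  (k : X -> dist R Y) : convex_comb (dirac R x) k = k x.
Proof.
apply: distP => y /=; rewrite (@fsum_single _ _ x).
  by rewrite asboolT// mul1r.
by move=> z zx; rewrite asboolF ?mul0r.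
Qed.

Lemma convex_combA (R : realType) (X Y Z : Type) (d : dist R X)
  (k : X -> dist R Y) (l : Y -> dist R Z) :
  convex_comb (convex_comb d k) l = convex_comb d (fun x => convex_comb (k x) l).
Proof.
apply: distP => z /=.
under eq_fsum do rewrite -fsum_mulr.
rewrite -(@fsum_exchange _ _ _ d (fun x y => k x y * l y z)).
- by apply: eq_fsum => y; apply: eq_fsum => x; rewrite mulrA.
- exact: coef_finite.
- move=> x; apply: sub_finite_set (coef_finite (k x)) => y.
  by rewrite /supp/= mulf_eq0 negb_or => /andP[].
Qed.

Definition dist_functor (R : realType) : functor Sets Sets.
Proof.
refine (@Functor Sets Sets (dist R) (@dist_map R) _ _).
- by move=> X; apply/funext => d; exact: convex_comb_dirac.
- move=> X Y Z g f; apply/funext => d /=; rewrite /dist_map convex_combA.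
  by congr convex_comb; apply/funext => x; rewrite dirac_convex_comb.
Defined.

Definition Distr (R : realType) : monad Sets.
Proof.
refine (@Monad Sets (dist_functor R) (@dirac R) (@dist_join R) _ _ _ _ _).
- by move=> X Y f; apply/funext => x; rewrite /= /dist_map dirac_convex_comb.
- move=> X Y f; apply/funext => d.
  rewrite /= /dist_map /dist_join !convex_combA.
  by congr convex_comb; apply/funext => e; rewrite dirac_convex_comb.
- move=> X; apply/funext => d.
  rewrite /= /dist_map /dist_join !convex_combA.
  by congr convex_comb; apply/funext => e; rewrite dirac_convex_comb.
- by move=> X; apply/funext => d; rewrite /= /dist_join dirac_convex_comb.
- move=> X; apply/funext => d; rewrite /= /dist_map /dist_join convex_combA.
  rewrite -[RHS]convex_comb_dirac; congr convex_comb; apply/funext => e.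
  by rewrite dirac_convex_comb.
Defined.

(** * Normalization *)

(** The subdistribution over [X] identified with [d : dist R (option X)]; the
    coefficient of [None] is the missing mass, so that [dirac R None] gives the
    zero formal sum. *)
Definition subdist (R : realType) (X : Type) (d : dist R (option X)) : X -> R :=
  fun x => d (Some x).

Lemma subdist_finite (R : realType) (X : Type) (d : dist R (option X)) :
  finite_set (supp (subdist d)).
Proof.
apply: (@finite_preimage _ _ _ (@Some X)) (coef_finite d).
by move=> x y _ _ [].
Qed.

Definition normalize_nonzero (R : realType) (X : Type) (d : dist R (option X))
  (d_neq0 : fsum (subdist d) <> 0) : dist R X.
Proof.
refine (@Dist R X (fun x => subdist d x / fsum (subdist d)) _ _ _).
- move=> x; rewrite divr_ge0 ?coef_ge0//.
  by apply: fsum_ge0 => y; exact: coef_ge0.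
- apply: sub_finite_set (subdist_finite d) => x.
  by rewrite /supp/= mulf_eq0 negb_or => /andP[].
- by rewrite fsum_mulr divff//; apply/eqP.
Defined.

Definition normalize (R : realType) (X : Type) (d : dist R (option X)) :
  option (dist R X) :=
  match pselect (fsum (subdist d) = 0) with
  | left _ => None
  | right d_neq0 => Some (normalize_nonzero d_neq0)
  end.

(* Main.v *)
Require Import Defs.
From mathcomp Require Import all_boot all_order all_algebra.
From mathcomp Require Import boolp classical_sets functions cardinality fsbigop.
From mathcomp Require Import reals.

(** Normalizing a subdistribution yields the unique distribution proportional
    to it, and fails exactly on the zero subdistribution.  This relational
    description, packaged in [normalizeP] for reading off the result and in
    [normalize_proportional] and [normalize_zero] for computing it, mentions
    neither the total mass nor a division, and every axiom reduces to it.

    Naturality holds because pushing forward along a map is linear, hence sends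
    proportional (respectively zero) subdistributions to proportional
    (respectively zero) ones; [convex_comb_defined] is what lets the point
    standing for the missing mass be ignored.  Compatibility with the
    multiplication of the maybe monad holds because being proportional is
    transitive: normalizing over [option X] and then over [X] rescales twice,
    and either step fails only if the coefficients on [X] vanish.  For the two
    unit laws the subdistribution is zero or is already a distribution, so the
    factor is [1]. *)

Set Implicit Arguments.
Unset Strict Implicit.
Unset Printing Implicit Defensive.
Import Order.TTheory GRing.Theory Num.Theory.
Local Open Scope classical_set_scope.
Local Open Scope ring_scope.

Lemma fsum_option (R : realType) (X : Type) (f : option X -> R) :
  f None = 0 -> fsum f = fsum (fun x => f (Some x)).
Proof.
move=> f0; rewrite /fsum.
pose some : {classic X} -> {classic option X} := @Some X.
transitivity (\sum_(m \in some @` setT) f m); last first.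
  by apply: fsbig_image => x y _ _ [].
by apply/esym/fsbig_widen => // -[x [_ nx]|] //.
Qed.

Lemma fsum_eq0 (R : realType) (X : Type) (f : X -> R) :
  finite_set (supp f) -> (forall x, 0 <= f x) -> fsum f = 0 ->
  forall x, f x = 0.
Proof.
move=> finf f0; rewrite /fsum (fsbig_supp _ setT) setTI.
have fin : finite_set (f @^-1` [set~ 0] : set {classic X}).
  by apply: sub_finite_set finf => x /eqP.
move=> /(pfsumr_eq0 fin (fun x _ => f0 x)) f_supp0 x.
by apply: contrapT => fx; exact/fx/f_supp0.
Qed.

(** The missing mass drops out of every coefficient of a pushforward except that
    of [None]; the rest is linear in the subdistribution underlying [d], which is
    what carries proportionality over. *)
Lemma convex_comb_defined (R : realType) (X Y : Type) (d : dist R (option X))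
    (k : option X -> dist R Y) (y : Y) :
  k None y = 0 -> convex_comb d k y = fsum (fun x => subdist d x * k (Some x) y).
Proof. by move=> k0; rewrite /= fsum_option// k0 mulr0. Qed.

(** The factor [c] is forced to be the total mass of [d], since [e] has total
    mass [1]; so [e] is the quotient that defines normalization. *)
Lemma normalize_proportional (R : realType) (X : Type) (d : dist R (option X))
    (e : dist R X) (c : R) :
  c != 0 -> (forall x, subdist d x = c * e x) -> normalize d = Some e.
Proof.
move=> c0 dE.
have mass : fsum (subdist d) = c by rewrite (eq_fsum dE) fsum_mull coef_sum1 mulr1.
rewrite /normalize; case: pselect => [m0|m0].
  by rewrite -mass m0 eqxx in c0.
by congr Some; apply: distP => x /=; rewrite mass dE mulrC mulKf.
Qed.

Lemma normalize_zero (R : realType) (X : Type) (d : dist R (option X)) :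
  (forall x, subdist d x = 0) -> normalize d = None.
Proof.
move=> d0; rewrite /normalize; case: pselect => // -[].
by apply: fsbig1 => x _; exact: d0.
Qed.

Variant normalize_spec (R : realType) (X : Type) (d : dist R (option X)) :
    option (dist R X) -> Prop :=
  | NormalizeZero of (forall x, subdist d x = 0) : normalize_spec d None
  | NormalizeProportional (e : dist R X) (c : R) of c != 0 &
      (forall x, subdist d x = c * e x) : normalize_spec d (Some e).

(** Nonnegative coefficients with zero total vanish individually, so the zero
    test on the mass is a zero test on the subdistribution. *)
Lemma normalizeP (R : realType) (X : Type) (d : dist R (option X)) :
  normalize_spec d (normalize d).
Proof.
rewrite /normalize; case: pselect => [m0|m0].
  constructor; apply: fsum_eq0 m0; first exact: subdist_finite.
  by move=> x; exact: coef_ge0.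
apply: (@NormalizeProportional _ _ _ _ (fsum (subdist d))); first exact/eqP.
by move=> x /=; rewrite mulrC divfK//; apply/eqP.
Qed.

Lemma normalize_natural (R : realType) (X Y : Type) (f : X -> Y)
    (d : dist R (option X)) :
  normalize (dist_map (omap f) d) = omap (dist_map f) (normalize d).
Proof.
have mapE y : subdist (dist_map (omap f) d) y =
    fsum (fun x => subdist d x * dirac R (f x) y).
  rewrite /subdist /dist_map convex_comb_defined /=; last by rewrite asboolF.
  by apply: eq_fsum => x; congr (_ * (_ : bool)%:R); apply: asbool_equiv_eq;
     split=> [[]|->].
case: (normalizeP d) => [d0|e c c0 dE] /=.
  apply: normalize_zero => y; rewrite mapE; apply: fsbig1 => x _.
  by rewrite d0 mul0r.
apply: (normalize_proportional c0) => y; rewrite mapE -fsum_mull.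
by apply: eq_fsum => x; rewrite dE mulrA.
Qed.

Lemma subdist_map_join (R : realType) (X : Type)
    (d : dist R (option (option X))) (x : X) :
  subdist (dist_map (@maybe_join X) d) x = d (Some (Some x)).
Proof.
rewrite /subdist /= (@fsum_single _ _ (Some (Some x))).
  by rewrite asboolT// mulr1.
move=> m mx; rewrite asboolF ?mulr0// => mE; apply: mx.
by case: m mE => //= m <-.
Qed.

Lemma normalize_maybe_join (R : realType) (X : Type)
    (d : dist R (option (option X))) :
  normalize (dist_map (@maybe_join X) d) =
  maybe_join (omap (@normalize R X) (normalize d)).
Proof.
case: (normalizeP d) => [d0|e c c0 dE] /=.
  by apply: normalize_zero => x; rewrite subdist_map_join; exact: d0.
case: (normalizeP e) => [e0|g b b0 eE].
  apply: normalize_zero => x; rewrite subdist_map_join.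
  by rewrite [LHS]dE [e _]e0 mulr0.
apply: (@normalize_proportional _ _ _ _ (c * b)); first by rewrite mulf_neq0.
by move=> x; rewrite subdist_map_join [LHS]dE [e _]eE mulrA.
Qed.

Lemma normalize_dirac (R : realType) (X : Type) (m : option X) :
  normalize (dirac R m) = omap (@dirac R X) m.
Proof.
case: m => [x|] /=; last by apply: normalize_zero => x; rewrite /subdist/= asboolF.
apply: (normalize_proportional (oner_neq0 R)) => y.
rewrite mul1r /subdist /=; congr (_ : bool)%:R.
by apply: asbool_equiv_eq; split=> [[]|->].
Qed.

Lemma normalize_map_Some (R : realType) (X : Type) (d : dist R X) :
  normalize (dist_map Some d) = Some d.
Proof.
apply: (normalize_proportional (oner_neq0 R)) => x.
rewrite mul1r /subdist /= (@fsum_single _ _ x).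
  by rewrite asboolT// mulr1.
by move=> y yx; rewrite asboolF ?mulr0// => -[xy]; apply: yx.
Qed.

Theorem proposition3p2 (R : realType) :
  almost_distributive_law (Distr R) Maybe (@normalize R).
Proof.
split.
- by move=> X Y f; apply/funext => d; exact: normalize_natural.
- by move=> X; apply/funext => d; exact: normalize_maybe_join.
- by move=> X; apply/funext => m; exact: normalize_dirac.
- by move=> X; apply/funext => d; exact: normalize_map_Some.
Qed.
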